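(* Let $i,k,r,s\ge 1$ and $n\ge -1$ be integers. The number of tilings of an $(n+1)$-board using $1\times 1$ black squares, $i$-rectangles each coloured with one of $r$ colours, and $k$-rectangles each coloured with one of $s$ colours, such that black squares can only appear in the first $\min\{i,k\}-1$ positions of the board, is equal to $F^{i}_{r,s}(k,n)$.
   Context: For integers $i,k,r,s\ge 1$, the sequence $F^{i}_{r,s}(k,n)$, $n\ge -1$, is defined as follows. If $i\le k$, then $F^{i}_{r,s}(k,n)=r^{\lfloor (n+1)/i\rfloor}$ for $n=-1,0,\ldots,k-2$; if $k<i$, then $F^{i}_{r,s}(k,n)=s^{\lfloor (n+1)/k\rfloor}$ for $n=-1,0,\ldots,i-2$; and for all $n\ge \max\{k,i\}-1$, $F^{i}_{r,s}(k,n)=rF^{i}_{r,s}(k,n-i)+sF^{i}_{r,s}(k,n-k)$. An $(n+1)$-board is a $1\times(n+1)$ strip of cells, with positions numbered $1,\ldots,n+1$ from left to right (the $0$-board has exactly one, empty, tiling). An $i$-rectangle (respectively $k$-rectangle) is a $1\times i$ (respectively $1\times k$) piece. Black squares, $i$-rectangles and $k$-rectangles are regarded as distinct kinds of pieces even if their sizes coincide (so if $i=k$ there are $r+s$ different pieces of that size). *)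

(* Defs.v *)
From HB Require Import structures.
From mathcomp Require Import all_boot all_order all_algebra.
From mathcomp Require Import zify.

Set Implicit Arguments.
Unset Strict Implicit.
Unset Printing Implicit Defensive.

Local Open Scope nat_scope.

(* [Frec] is the sequence indexed by [m = n + 1 >= 0]; [fuel] only serves the
   structural recursion and is irrelevant as soon as [m < fuel] and i, k >= 1. *)
Fixpoint Frec (i r s k fuel m : nat) : nat :=
  if fuel is fuel'.+1 then
    if m < maxn k i then
      if i <= k then r ^ (m %/ i) else s ^ (m %/ k)
    else r * Frec i r s k fuel' (m - i) + s * Frec i r s k fuel' (m - k)
  else 0.

(* The value at n < -1 is junk. *)
Definition F (i r s k : nat) (n : int) : nat :=
  Frec i r s k (absz (n + 1)%R).+1 (absz (n + 1)%R).

Lemma Frec_fuel (i r s k : nat) : 0 < i -> 0 < k ->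
  forall f f' m, m < f -> m < f' -> Frec i r s k f m = Frec i r s k f' m.
Proof.
move=> i0 k0; elim=> [|f IH] [|f'] m //= mf mf'.
case: ltnP => // km.
by congr (_ * _ + _ * _); apply: IH; lia.
Qed.

Lemma F_init_le (i r s k : nat) (n : int) :
  0 < i -> i <= k -> (-1 <= n <= k%:Z - 2)%R ->
  F i r s k n = r ^ (absz (n + 1)%R %/ i).
Proof. by move=> i0 ik nk; rewrite /F /= ifT ?ik //; lia. Qed.

Lemma F_init_gt (i r s k : nat) (n : int) :
  0 < k -> k < i -> (-1 <= n <= i%:Z - 2)%R ->
  F i r s k n = s ^ (absz (n + 1)%R %/ k).
Proof.
move=> k0 ki nk; rewrite /F /= ifT; last by lia.
by rewrite ifF //; lia.
Qed.

Lemma F_rec (i r s k : nat) (n : int) :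
  0 < i -> 0 < k -> ((maxn k i)%:Z - 1 <= n)%R ->
  F i r s k n = r * F i r s k (n - i%:Z)%R + s * F i r s k (n - k%:Z)%R.
Proof.
move=> i0 k0 kn; rewrite {1}/F /= ifF; last by lia.
by congr (_ * _ + _ * _); rewrite /F;
  [have -> : absz (n - i%:Z + 1)%R = absz (n + 1)%R - i by lia
  |have -> : absz (n - k%:Z + 1)%R = absz (n + 1)%R - k by lia];
  apply: Frec_fuel => //; lia.
Qed.

Inductive piece (r s : nat) : Type :=
  | Black
  | IRect of 'I_r
  | KRect of 'I_s.
Arguments Black {r s}.
Arguments IRect {r s}.
Arguments KRect {r s}.

Section PieceFinType.
Variables r s : nat.

Definition piece_code (p : piece r s) : option ('I_r + 'I_s) :=
  match p with
  | Black => None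
  | IRect c => Some (inl c)
  | KRect c => Some (inr c)
  end.

Definition piece_decode (x : option ('I_r + 'I_s)) : piece r s :=
  match x with
  | None => Black
  | Some (inl c) => IRect c
  | Some (inr c) => KRect c
  end.

Lemma piece_codeK : cancel piece_code piece_decode. Proof. by case. Qed.

HB.instance Definition _ := Equality.copy (piece r s) (can_type piece_codeK).
HB.instance Definition _ := Choice.copy (piece r s) (can_type piece_codeK).
HB.instance Definition _ := Countable.copy (piece r s) (can_type piece_codeK).
HB.instance Definition _ := Finite.copy (piece r s) (can_type piece_codeK).

End PieceFinType.

Definition plen (i k : nat) (r s : nat) (p : piece r s) : nat :=
  match p with Black => 1 | IRect _ => i | KRect _ => k end.

Definition is_black (r s : nat) (p : piece r s) : bool :=
  if p is Black then true else false.

(* A placed piece is a pair [x] of its leftmost cell and its kind. The cells of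
   the m-board are the elements of ['I_m]; cell [c] is at position [c.+1]. *)
Definition covers (i k r s m : nat) (x : 'I_m * piece r s) (c : 'I_m) : bool :=
  x.1 <= c < x.1 + plen i k x.2.

Definition is_tiling (i k r s m : nat) (A : {set 'I_m * piece r s}) : bool :=
  [forall x in A, x.1 + plen i k x.2 <= m] &&
  [forall c : 'I_m, #|[set x in A | covers i k x c]| == 1].

Definition black_restricted (i k r s m : nat) (A : {set 'I_m * piece r s}) :
    bool :=
  [forall x in A, is_black x.2 ==> (x.1.+1 <= minn i k - 1)].

Definition tilings (i k r s m : nat) : {set {set 'I_m * piece r s}} :=
  [set A | is_tiling i k A && black_restricted i k A].

(* Main.v *)
(** Removing the piece that covers the last cell of a tiled board leaves a tiling
    of a shorter board, and a black square can be that piece only when the board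
    has fewer than [minn i k] cells. Hence, for [m > 0], the number of tilings is
    [f m = f (m - 1) + r * f (m - i) + s * f (m - k)], where the first term is
    present only if [m < minn i k], the second only if [i <= m] and the third
    only if [k <= m]. The initial values and the recurrence of [F] are all cases
    of this identity. *)
Require Import Defs.
From mathcomp Require Import all_boot all_order all_algebra.
From mathcomp Require Import zify.

Set Implicit Arguments.
Unset Strict Implicit.
Unset Printing Implicit Defensive.

Section Tilings.

Variables i k r s : nat.
Hypotheses (i_gt0 : 0 < i) (k_gt0 : 0 < k).

Implicit Types (m n : nat) (p : piece r s).

Lemma plen_gt0 p : 0 < plen i k p.
Proof. by case: p. Qed.

(** Exactly one covering piece per cell is split into existence and uniqueness, which the overlap
    arguments use separately. *)
Lemma tilingsP m (A : {set 'I_m * piece r s}) :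
  reflect
    [/\ forall x, x \in A -> x.1 + plen i k x.2 <= m,
        forall c, exists2 x, x \in A & covers i k x c,
        forall c x y, x \in A -> y \in A ->
          covers i k x c -> covers i k y c -> x = y
      & forall x, x \in A -> is_black x.2 -> x.1.+1 <= minn i k - 1]
    (A \in tilings i k r s m).
Proof.
rewrite inE; apply: (iffP idP).
  case/andP=> /andP[/forall_inP fitA /forallP cardA] /forall_inP blackA.
  split=> // [c | c x y xA yA xc yc | x xA]; last exact/implyP/blackA.
    have /cards1P[x defx] := cardA c.
    by move: (set11 x); rewrite -defx inE => /andP[]; exists x.
  have /cards1P[z defz] := cardA c.
  have /set1P -> : x \in [set z] by rewrite -defz inE xA.
  by apply/esym/set1P; rewrite -defz inE yA.
case=> fitA exA uniqA blackA; apply/andP; split; last first.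
  by apply/forall_inP=> x xA; apply/implyP/blackA.
apply/andP; split; first exact/forall_inP.
apply/forallP=> c; have [x xA xc] := exA c.
apply/cards1P; exists x; apply/setP=> y; rewrite !inE.
apply/andP/eqP=> [[yA yc] | -> //]; exact: uniqA yc xc.
Qed.

Lemma card_tilings0 : #|tilings i k r s 0| = 1.
Proof.
apply/eqP/cards1P; exists set0; apply/setP=> A; rewrite in_set1.
have -> : A = set0 by apply/setP=> -[[]].
by rewrite eqxx; apply/tilingsP; split=> [[[]]|[]|[]|[[]]].
Qed.

(** The colour is part of [p], so a tiling is classified by both shape and colour of the piece that
    reaches the right end. *)
Definition ends_with m p (A : {set 'I_m * piece r s}) : bool :=
  [exists x in A, (x.1 + plen i k x.2 == m) && (x.2 == p)].

Section AddLast.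

Variables (m n : nat) (p : piece r s) (x0 : 'I_m) (le_nm : n <= m).
Hypotheses (x0E : x0 = n :> nat) (def_m : n + plen i k p = m).

Definition widen_placed (x : 'I_n * piece r s) : 'I_m * piece r s :=
  (widen_ord le_nm x.1, x.2).

Definition add_last (B : {set 'I_n * piece r s}) : {set 'I_m * piece r s} :=
  (x0, p) |: widen_placed @: B.

Lemma widen_placed_inj : injective widen_placed.
Proof.
by move=> [a b] [c d] [ac ->]; congr (_, _); apply: val_inj.
Qed.

Lemma widen_placed_neq y : widen_placed y != (x0, p).
Proof.
apply/eqP=> -[/(congr1 val) /= E _].
by have := ltn_ord y.1; rewrite E x0E ltnn.
Qed.

(** The new piece starts at cell [n], outside the [n]-board, so the preimage forgets it and keeps
    all the others. This makes [add_last] injective. *)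
Lemma preim_add_last : cancel add_last (fun A => widen_placed @^-1: A).
Proof.
move=> B; apply/setP=> y; rewrite !inE (negPf (widen_placed_neq y)) /=.
exact/mem_imset/widen_placed_inj.
Qed.

(** An appended black square occupies position [m], hence the bound [m < minn i k]. *)
Lemma add_last_tilings (B : {set 'I_n * piece r s}) :
  is_black p ==> (m < minn i k) -> B \in tilings i k r s n ->
  (add_last B \in tilings i k r s m) && ends_with p (add_last B).
Proof.
move=> okp /tilingsP[fitB exB uniqB blackB]; apply/andP; split; last first.
  by apply/exists_inP; exists (x0, p); rewrite ?setU11 //= x0E def_m !eqxx.
(* Old pieces end within the first [n] cells, and the new piece starts right after them. *)
have disj y c : y \in B -> covers i k (widen_placed y) c ->
    covers i k (x0, p) c -> False.
  by move=> /fitB; rewrite /covers /= x0E; lia.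
apply/tilingsP; split.
- move=> x /setU1P[-> /= | /imsetP[y /fitB yB -> /=]]; last exact: leq_trans yB _.
  by rewrite x0E def_m.
- move=> c; case: (ltnP c n) => [cn | nc].
    have [y yB yc] := exB (Ordinal cn).
    by exists (widen_placed y) => //; rewrite setU1r // imset_f.
  by exists (x0, p); rewrite ?setU11 // /covers /= x0E nc def_m ltn_ord.
- move=> c x y /setU1P[-> | /imsetP[x' x'B ->]] /setU1P[-> | /imsetP[y' y'B ->]] //.
  + by move=> ? /disj; case/(_ y'B).
  + by move=> /disj; move/(_ x'B).
  move=> x'c y'c; congr widen_placed.
  have cn : c < n by have := fitB _ x'B; move: x'c; rewrite /covers /=; lia.
  exact: (uniqB (Ordinal cn)).
- move=> x /setU1P[-> /= bp | /imsetP[y yB -> /=]]; last exact: blackB.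
  have pl : plen i k p = 1 by case: (p) bp.
  by move: okp; rewrite bp /= x0E; lia.
Qed.

(** A piece of kind [p] ending at [m] must start at [n]. Every other piece avoids its cells and so
    lies in the [n]-board; these pieces tile that board. *)
Lemma add_last_onto (A : {set 'I_m * piece r s}) :
  A \in tilings i k r s m -> ends_with p A ->
  [/\ is_black p ==> (m < minn i k),
      widen_placed @^-1: A \in tilings i k r s n
    & add_last (widen_placed @^-1: A) = A].
Proof.
move=> /tilingsP[fitA exA uniqA blackA] /exists_inP[[x q] xA /= /andP[/eqP xm /eqP qp]].
have pl := plen_gt0 p.
have {q qp x xm xA} x0A : (x0, p) \in A.
  by rewrite qp in xm xA; rewrite (_ : x0 = x) //; apply: ord_inj; rewrite x0E; lia.
have ltn_A y : y \in A -> y != (x0, p) -> y.1 + plen i k y.2 <= n.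
  move=> yA; apply: contra_neqT; rewrite -ltnNge => ny.
  have yl := plen_gt0 y.2; have fity := fitA _ yA; have ym := ltn_ord y.1.
  (* [y] and the last piece overlap in the cell [max y.1 n] *)
  have cm : maxn y.1 n < m by lia.
  apply: (uniqA (Ordinal cm)) => //; rewrite /covers /= ?x0E.
    by rewrite leq_maxl gtn_max ny -addn1 leq_add2l yl.
  by rewrite leq_maxr def_m cm.
split.
- apply/implyP=> bp; have /= := blackA _ x0A bp; rewrite x0E.
  have p1 : plen i k p = 1 by case: (p) bp.
  lia.
- apply/tilingsP; split.
  + by move=> y; rewrite inE => yA; apply: (ltn_A _ yA (widen_placed_neq y)).
  + move=> c; have [y yA yc] := exA (widen_ord le_nm c).
    have yn : y.1 < n by move: yc; rewrite /covers /=; have := ltn_ord c; lia.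
    have defy : widen_placed (Ordinal yn, y.2) = y.
      by rewrite [RHS]surjective_pairing; congr (_, _); apply: val_inj.
    by exists (Ordinal yn, y.2); rewrite ?inE ?defy.
  + move=> c y z; rewrite !inE => yA zA yc zc; apply: widen_placed_inj.
    exact: (uniqA (widen_ord le_nm c)).
  + by move=> y; rewrite inE => yA; apply: blackA yA.
apply/setP=> y; rewrite in_setU1; have [-> // | yx0] := eqVneq y.
apply/imsetP/idP => /= [[z + ->] | yA]; first by rewrite inE.
have yn : y.1 < n by have := ltn_A y yA yx0; have := plen_gt0 y.2; lia.
have defy : widen_placed (Ordinal yn, y.2) = y.
  by rewrite [RHS]surjective_pairing; congr (_, _); apply: val_inj.
by exists (Ordinal yn, y.2); rewrite ?inE defy.
Qed.

End AddLast.

(** When [p] fits and is allowed at the end, [add_last] is a bijection from the tilings of the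
    shorter board; otherwise no tiling ends with [p]. *)
Lemma card_ends_with m p :
  #|[set A in tilings i k r s m | ends_with p A]| =
  if (plen i k p <= m) && (is_black p ==> (m < minn i k))
  then #|tilings i k r s (m - plen i k p)| else 0.
Proof.
have pl := plen_gt0 p.
have [pm | mp] := leqP (plen i k p) m => /=; last first.
  apply/eqP; rewrite cards_eq0; apply/eqP/setP=> A; rewrite !inE.
  apply/andP=> -[_ /exists_inP[x xA /andP[/eqP xm /eqP xp]]].
  by move: xm; rewrite xp; lia.
have x0m : m - plen i k p < m by lia.
have le_nm := leq_subr (plen i k p) m.
pose x0 := Ordinal x0m; have def_m := subnK pm.
have ontoA := @add_last_onto m _ p x0 le_nm erefl def_m.
case: ifP => [okp | /negP nokp]; last first.
  apply/eqP; rewrite cards_eq0; apply/eqP/setP=> A; rewrite in_set0.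
  by apply/negP => /setIdP[At Ae]; have [/nokp] := ontoA A At Ae.
have addK := @preim_add_last m _ p x0 le_nm erefl.
rewrite -(card_imset _ (can_inj addK)); apply: eq_card => A.
apply/setIdP/imsetP => [[At Ae] | [B Bt ->]].
  by have [_ Bt defA] := ontoA A At Ae; exists (widen_placed le_nm @^-1: A).
exact/andP/add_last_tilings.
Qed.

Lemma card_tilings_sum m : 0 < m ->
  #|tilings i k r s m| =
  \sum_p #|[set A in tilings i k r s m | ends_with p A]|.
Proof.
move=> m_gt0; under [RHS]eq_bigr do rewrite -sum1dep_card big_mkcondr /=.
(* Double counting: after the exchange, each tiling must contribute 1, that is, end with exactly one
   kind: that of the piece covering the last cell. *)
rewrite exchange_big /= -sum1_card; apply: eq_bigr => A.
case/tilingsP=> fitA exA uniqA _; rewrite -big_mkcond /=.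
have cm : m.-1 < m by rewrite prednK.
have [x xA xc] := exA (Ordinal cm).
rewrite (big_pred1 x.2) // => p; apply/exists_inP/eqP => [[y yA] | ->].
  case/andP=> /eqP ym /eqP <-; congr _.2; apply: (uniqA (Ordinal cm)) => //.
  by rewrite /covers /= -ltnS ym prednK // ltn_ord leqnn.
exists x => //; rewrite eqxx andbT; have := fitA x xA.
by move: xc; rewrite /covers /=; lia.
Qed.

Lemma big_piece (f : piece r s -> nat) :
  \sum_p f p = f Black + \sum_c f (IRect c) + \sum_c f (KRect c).
Proof.
have bij : bijective (@piece_decode r s).
  by exists (@piece_code r s); [case=> [[]|] | exact: piece_codeK].
rewrite (reindex _ (onW_bij _ bij)) (bigD1 None) //= -addnA; congr (_ + _).
rewrite (reindex_omap Some id) /=; last by case.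
rewrite (eq_bigl xpredT) => [|c]; last by rewrite eqxx.
by rewrite big_sumType.
Qed.

Lemma card_tilings_rec m : 0 < m ->
  #|tilings i k r s m| =
    (if m < minn i k then #|tilings i k r s m.-1| else 0)
    + r * (if i <= m then #|tilings i k r s (m - i)| else 0)
    + s * (if k <= m then #|tilings i k r s (m - k)| else 0).
Proof.
move=> m_gt0; rewrite card_tilings_sum // big_piece.
rewrite card_ends_with /= m_gt0 subn1.
under eq_bigr do rewrite card_ends_with /= andbT.
under [X in _ + _ + X]eq_bigr do rewrite card_ends_with /= andbT.
by rewrite !sum_nat_const !card_ord.
Qed.

(** No rectangle fits, so only the all-black tiling remains. *)
Lemma card_tilings_small m : m < minn i k -> #|tilings i k r s m| = 1.
Proof.
elim: m => [|m IHm] lt_m; first exact: card_tilings0.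
rewrite card_tilings_rec // lt_m !ifF ?muln0 ?addn0; try lia.
by apply: IHm; lia.
Qed.

Lemma card_tilingsE m fuel :
  m < fuel -> #|tilings i k r s m| = Frec i r s k fuel m.
Proof.
(* This turns the closed initial values into one-term recurrences such as
   [r ^ (m %/ i) = r * r ^ ((m - i) %/ i)]. *)
have divnB1 n d : 0 < d -> d <= n -> n %/ d = ((n - d) %/ d).+1.
  by move=> d_gt0 le_dn; rewrite -{1}(subnK le_dn) divnDr // divnn d_gt0 addn1.
elim: fuel m => // fuel IH m lt_m /=.
have [lt_min | min_le] := ltnP m (minn i k).
  have [lt_mi lt_mk] : m < i /\ m < k by lia.
  have -> : m < maxn k i by lia.
  by rewrite card_tilings_small // !divn_small ?expn0 ?if_same.
rewrite card_tilings_rec; last lia.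
rewrite [m < minn i k]ltnNge min_le /= add0n.
(* From the maximum on, both rectangles fit and the identity is the recurrence of [Frec]. Between
   the minimum and the maximum, only the shorter rectangle fits. *)
have [m_max | max_m] := ltnP m (maxn k i); last first.
  have [-> ->] : i <= m /\ k <= m by lia.
  by rewrite !IH //; lia.
have [le_ik | lt_ki] := leqP i k.
  have [le_im lt_mk] : i <= m /\ m < k by lia.
  rewrite le_im [k <= m]leqNgt lt_mk /= muln0 addn0 IH; last lia.
  (* [Frec] at [m - i] needs one more unit of fuel to unfold to its initial value; there is one
     because [m >= i > 0]. *)
  case: (fuel) lt_m => [|f] lt_m; first lia.
  have lt_max : m - i < maxn k i by lia.
  by rewrite /= lt_max le_ik (divnB1 m) // expnS.
have [le_km lt_mi] : k <= m /\ m < i by lia.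
rewrite le_km [i <= m]leqNgt lt_mi /= muln0 add0n IH; last lia.
case: (fuel) lt_m => [|f] lt_m; first lia.
have lt_max : m - k < maxn k i by lia.
by rewrite /= lt_max [i <= k]leqNgt lt_ki /= (divnB1 m) // expnS.
Qed.

End Tilings.

Theorem theorem3p1 (i k r s : nat) (n : int)
  (hi : (1 <= i)%N) (hk : (1 <= k)%N) (hr : (1 <= r)%N) (hs : (1 <= s)%N)
  (hn : (-1 <= n)%R) :
  #|tilings i k r s (absz (n + 1)%R)| = F i r s k n.
Proof. exact: card_tilingsE. Qed.
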